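(* Let $\mathcal{X}$ be a set, $E$ a Banach space, and let $\mathcal{B}$ be a GRKBS of functions $\mathcal{X}\to E$ with configuration $(\mathcal{F},\phi)$. Let $\widetilde{\mathcal{F}}$ be another Banach space with $\widetilde{\mathcal{F}}\cong\mathcal{F}$, and let $\mathcal{J}:\widetilde{\mathcal{F}}\to\mathcal{F}$ be an isometric isomorphism. Then $\widetilde{\mathcal{F}}/\widetilde{\mathcal{N}}\cong\mathcal{B}$, where $$\widetilde{\mathcal{N}}=\{\widetilde\mu\in\widetilde{\mathcal{F}}:\phi(x)(\mathcal{J}\widetilde\mu)=0\ \ \forall x\in\mathcal{X}\}.$$ In other words, the pair $(\widetilde{\mathcal{F}},\widetilde\phi)$, where $\widetilde\phi:\mathcal{X}\to L_{\mathrm{op}}(\widetilde{\mathcal{F}},E)$ is defined by $\widetilde\phi(x)(\widetilde\mu)=\phi(x)(\mathcal{J}\widetilde\mu)$ for all $(x,\widetilde\mu)\in\mathcal{X}\times\widetilde{\mathcal{F}}$, is also a configuration of $\mathcal{B}$.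
   Context: $L_{\mathrm{op}}(\mathcal{F},E)$ denotes the bounded linear operators from $\mathcal{F}$ to $E$. The symbol $\cong$ means isometrically isomorphic (as Banach spaces). A GRKBS is a Banach space $\mathcal{B}$ of functions $f:\mathcal{X}\to E$ (pointwise operations) for which every evaluation operator $ev_x(f)=f(x)$ is bounded from $\mathcal{B}$ to $E$. A configuration of $\mathcal{B}$ is a pair $(\mathcal{F},\phi)$ with $\mathcal{F}$ a Banach space and $\phi:\mathcal{X}\to L_{\mathrm{op}}(\mathcal{F},E)$ such that $\mathcal{B}=\{f_\mu:\mu\in\mathcal{F}\}$, $f_\mu(x)=\phi(x)(\mu)$, and $\|f\|_{\mathcal{B}}=\inf\{\|\mu\|_{\mathcal{F}}:f=f_\mu\}$. Quotients of Banach spaces by closed subspaces carry the quotient norm. *)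

(* Defs.v *)
From HB Require Import structures.
From mathcomp Require Import all_boot all_order all_algebra.
From mathcomp Require Import generic_quotient ring_quotient.
From mathcomp.real_closed Require Import complex.
From mathcomp Require Import all_classical all_reals.
From mathcomp Require Import topology normedtype sequences.

Set Implicit Arguments.
Unset Strict Implicit.
Unset Printing Implicit Defensive.

Import Order.TTheory GRing.Theory Num.Theory.
Import numFieldNormedType.Exports.

Local Open Scope classical_set_scope.
Local Open Scope ring_scope.
Local Open Scope quotient_scope.

(* Scalar fields: every nonempty set of nonnegative scalars has an infimum.
   As norms are valued in the scalars, this is what is needed for norms defined
   by infima to exist; both R and R[i] are instances, for R : realType. *)
HB.mixin Record hasNormInf K & Num.NumField K := {
  ge0_infimums : forall A : set K,
    A !=set0 -> lbound A 0 -> infimums A !=set0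
}.

#[short(type="scalarFieldType")]
HB.structure Definition ScalarField := {K of Num.NumField K & hasNormInf K}.

Section real_scalars.
Variable R : realType.

Lemma real_ge0_infimums (A : set R) :
  A !=set0 -> lbound A 0 -> infimums A !=set0.
Proof.
move=> A0 lA; exists (inf A); split.
  by apply: ge_inf; exists 0.
by move=> y yA; apply: lb_le_inf.
Qed.

#[non_forgetful_inheritance]
HB.instance Definition _ := hasNormInf.Build R real_ge0_infimums.

Lemma complex_ge0_infimums (A : set R[i]) :
  A !=set0 -> lbound A 0 -> infimums A !=set0.
Proof.
move=> [a Aa] lA.
have real_ge0 z : A z -> z = (complex.Re z)%:C%C.
  by move=> /lA; case: z => x y; rewrite lecE /= => /andP[/eqP -> _].
have [m [lm um]] : infimums (@complex.Re R @` A) !=set0.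
  apply: real_ge0_infimums; first by exists (complex.Re a), a.
  by move=> _ [z Az <-]; have := lA _ Az; rewrite lecE => /andP[_].
exists m%:C%C; split=> [z Az|y yA].
  by rewrite (real_ge0 _ Az) lecR; apply: lm; exists z.
have yE : y = (complex.Re y)%:C%C.
  have := yA _ Aa; rewrite (real_ge0 _ Aa); case: y {yA} => x y.
  by rewrite lecE /= => /andP[/eqP <- _].
rewrite yE lecR; apply: um => _ [z Az <-].
by have := yA _ Az; rewrite lecE => /andP[_].
Qed.

#[non_forgetful_inheritance]
HB.instance Definition _ := hasNormInf.Build R[i] complex_ge0_infimums.

End real_scalars.

Section infimum.
Variable K : scalarFieldType.
Implicit Types A : set K.

Lemma infimumP A : A !=set0 -> lbound A 0 -> infimums A (infimum 0 A).
Proof.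
move=> A0 lA; rewrite /infimum ifF; last by apply/negbTE/set0P.
by have [m Am] := @ge0_infimums K A A0 lA; apply: xgetPex; exists m.
Qed.

Lemma infimum_lt A (e : K) : A !=set0 -> lbound A 0 -> 0 < e ->
  exists2 a, A a & a < infimum 0 A + e.
Proof.
move=> A0 lA e0; have [lm um] := infimumP A0 lA.
have m0 : 0 <= infimum 0 A by exact: um.
apply: contrapT => H.
suff /um : lbound A (infimum 0 A + e).
  by rewrite gerDl => /(lt_le_trans e0); rewrite ltxx.
move=> a Aa.
rewrite real_leNgt; [|exact/ger0_real/addr_ge0/ltW|exact/ger0_real/lA].
by apply/negP => ?; apply: H; exists a.
Qed.

Lemma scalar_half_small (e : K) : 0 < e -> exists n, 2^-1 ^+ n < e.
Proof.
move=> e0; pose A := [set 2^-1 ^+ n | n in @setT nat] : set K.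
have A0 : A !=set0 by exists 1; exists 0%N => //; rewrite expr0.
have lA : lbound A 0 by move=> _ [n _ <-]; apply: exprn_ge0; rewrite invr_ge0.
have [lm um] := infimumP A0 lA.
have m0 : infimum 0 A <= 0.
  suff /um : lbound A (infimum 0 A *+ 2) by rewrite mulr2n gerDl.
  move=> _ [n _ <-]; have : infimum 0 A <= 2^-1 ^+ n.+1 by apply: lm; exists n.+1.
  by rewrite exprSr ler_pdivlMr// mulr_natr.
have [_ [n _ <-] ne] := infimum_lt A0 lA e0.
by exists n; rewrite (lt_le_trans ne)// gerDr.
Qed.

End infimum.

Section bounded_operators.
Variable K : scalarFieldType.

(* Over R[i] the inequality is one of complex numbers: for u != 0 it forces M
   to be real. *)
Definition bounded_op (U V : normedModType K) (f : U -> V) :=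
  exists M : K, forall u, `|f u| <= M * `|u|.

Record Lop (U V : normedModType K) := MkLop {
  lop_fun :> {linear U -> V};
  lop_bounded : bounded_op lop_fun
}.

(* `iso_bij` and `iso_norm` make the inverse linear and isometric too. *)
Record isoIsom (U V : normedModType K) := IsoIsom {
  iso_fun :> {linear U -> V};
  iso_bij : bijective iso_fun;
  iso_norm : forall u, `|iso_fun u| = `|u|
}.

Definition isom_isomorphic (U V : completeNormedModType K) :=
  inhabited (isoIsom U V).

Lemma lop_iso_bounded (U V W : normedModType K) (T : Lop V W)
  (J : isoIsom U V) : bounded_op (T \o J).
Proof.
have [M TM] := lop_bounded T; exists M => u /=.
by rewrite -(iso_norm J); apply: TM.
Qed.

Definition lop_comp_iso (U V W : normedModType K) (T : Lop V W)
  (J : isoIsom U V) : Lop U W :=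
  @MkLop U W (T \o J : {linear U -> W}) (lop_iso_bounded T J).

Lemma lop_continuous (U V : normedModType K) (T : Lop U V) : continuous T.
Proof.
apply: bounded_linear_continuous; have [M TM] := lop_bounded T.
apply/ex_bound; exists `|M|; apply/nbhs_norm0P; exists 1 => //= x /= x1.
have [->|x0] := eqVneq x 0; first by rewrite linear0 normr0.
have x_gt0 : 0 < `|x| by rewrite normr_gt0.
have M0 : 0 <= M by rewrite -(pmulr_lge0 _ x_gt0) (le_trans _ (TM x)).
by rewrite (le_trans (TM x))// ger0_norm// ler_piMr// ltW.
Qed.

End bounded_operators.

Section quotient_space.
Variables (K : scalarFieldType) (V : normedModType K).

Record closedSubspace := ClosedSubspace {
  csub_set : set V;
  csub0 : csub_set 0;
  csubD : forall u v, csub_set u -> csub_set v -> csub_set (u + v);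
  csubZ : forall (a : K) u, csub_set u -> csub_set (a *: u);
  csub_closed : closed csub_set
}.

Definition csub_pred (N : closedSubspace) : pred V := fun u => `[< csub_set N u >].

Lemma csub_zmod_closed N : zmod_closed (csub_pred N).
Proof.
split=> [|u v /asboolP Nu /asboolP Nv]; apply/asboolP; first exact: csub0.
by apply: csubD => //; rewrite -scaleN1r; exact: csubZ.
Qed.

HB.instance Definition _ N :=
  GRing.isZmodClosed.Build V (csub_pred N) (csub_zmod_closed N).

Definition quotSpace (N : closedSubspace) :=
  Quotient.quot (GRing.ZmodClosed.clone V (csub_pred N) _).

Variable N : closedSubspace.
Local Notation Q := (quotSpace N).

HB.instance Definition _ := EqQuotient.on Q.
HB.instance Definition _ := Choice.on Q.
HB.instance Definition _ := ZmodQuotient.on Q.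

Lemma pi_eqP (u v : V) : (\pi_Q u = \pi_Q v) <-> csub_set N (u - v).
Proof.
split=> [/eqP|Nuv]; first by rewrite -Quotient.idealrBE => /asboolP.
by apply/eqP; rewrite -Quotient.idealrBE; apply/asboolP.
Qed.

Definition qscale (a : K) (q : Q) : Q := \pi_Q (a *: repr q).

Lemma pi_scale a (u : V) : \pi_Q (a *: u) = qscale a (\pi_Q u).
Proof.
apply/pi_eqP; rewrite -scalerBr; apply/csubZ/pi_eqP; by rewrite reprK.
Qed.

Lemma pi_add (u v : V) : \pi_Q (u + v) = \pi_Q u + \pi_Q v.
Proof. by rewrite !piE. Qed.

Lemma qscaleA a b q : qscale a (qscale b q) = qscale (a * b) q.
Proof.
by rewrite -[q]reprK -(pi_scale b) -(pi_scale a) -(pi_scale (a * b)) scalerA.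
Qed.

Lemma qscale1 : left_id 1 qscale.
Proof. by move=> q; rewrite -[q]reprK -!pi_scale scale1r. Qed.

Lemma qscaleDr : right_distributive qscale +%R.
Proof.
by move=> a p q; rewrite -[p]reprK -[q]reprK -pi_add -!pi_scale scalerDr pi_add.
Qed.

Lemma qscaleDl q : {morph qscale^~ q : a b / a + b}.
Proof. by move=> a b; rewrite -[q]reprK -!pi_scale scalerDl pi_add. Qed.

HB.instance Definition _ := GRing.Zmodule_isLmodule.Build K Q
  qscaleA qscale1 qscaleDr qscaleDl.

Definition qnorm (q : Q) : K :=
  infimum 0 [set `|u| | u in [set u | \pi_Q u = q]].

Lemma qnorm_set_n0 q : [set `|u| | u in [set u | \pi_Q u = q]] !=set0.
Proof. by exists `|repr q|, (repr q) => //=; rewrite reprK. Qed.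

Lemma qnorm_set_ge0 q : lbound [set `|u| | u in [set u | \pi_Q u = q]] (0 : K).
Proof. by move=> _ [u _ <-]. Qed.

Lemma qnorm_ge0 q : 0 <= qnorm q.
Proof.
by have [_] := infimumP (qnorm_set_n0 q) (@qnorm_set_ge0 q); apply;
exact: qnorm_set_ge0.
Qed.

Lemma qnorm_le (u : V) : qnorm (\pi_Q u) <= `|u|.
Proof.
have [+ _] := infimumP (qnorm_set_n0 (\pi_Q u)) (@qnorm_set_ge0 (\pi_Q u)).
by apply; exists u.
Qed.

Lemma qnorm_lift q (e : K) : qnorm q < e -> exists2 u, \pi_Q u = q & `|u| < e.
Proof.
rewrite -subr_gt0 => e0.
have [_ [u uq <-]] := infimum_lt (qnorm_set_n0 q) (@qnorm_set_ge0 q) e0.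
by rewrite addrC subrK => ue; exists u.
Qed.

Lemma qnormD p q : qnorm (p + q) <= qnorm p + qnorm q.
Proof.
apply/ler_addgt0Pr => e e0.
have e20 : 0 < e / 2 by rewrite divr_gt0.
have [u up ue] : exists2 u, \pi_Q u = p & `|u| < qnorm p + e / 2.
  by apply: qnorm_lift; rewrite ltrDl.
have [v vp ve] : exists2 v, \pi_Q v = q & `|v| < qnorm q + e / 2.
  by apply: qnorm_lift; rewrite ltrDl.
rewrite -up -vp -pi_add (le_trans (qnorm_le _))// (le_trans (ler_normD _ _))//.
by rewrite [e]splitr addrACA up vp lerD// ltW.
Qed.

Lemma qnormZ_le a q : qnorm (a *: q) <= `|a| * qnorm q.
Proof.
apply/ler_addgt0Pr => e e0.
have a0 : 0 < `|a| + 1 by rewrite ltr_wpDl.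
have [u uq ue] : exists2 u, \pi_Q u = q & `|u| < qnorm q + e / (`|a| + 1).
  by apply: qnorm_lift; rewrite ltrDl divr_gt0.
rewrite -uq -[_ *: _]pi_scale (le_trans (qnorm_le _))// normrZ uq.
apply: (@le_trans _ _ (`|a| * (qnorm q + e / (`|a| + 1)))).
  by rewrite ler_wpM2l// ltW.
by rewrite mulrDr lerD2l mulrCA ler_piMr ?(ltW e0)// ler_pdivrMr// mul1r lerDl.
Qed.

Lemma qnormZ a q : qnorm (a *: q) = `|a| * qnorm q.
Proof.
apply/eqP; rewrite eq_le qnormZ_le/=; have [->|a0] := eqVneq a 0.
  by rewrite normr0 mul0r qnorm_ge0.
rewrite -[in leLHS](scale1r q) -(mulVf a0) -scalerA.
by rewrite mulrC -ler_pdivlMr ?normr_gt0// mulrC -normfV qnormZ_le.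
Qed.

Lemma qnorm0_eq0 q : qnorm q = 0 -> q = 0.
Proof.
move=> q0; have zeroE : (0 : Q) = \pi_Q 0 by rewrite piE.
rewrite -[q]reprK zeroE; apply/pi_eqP; rewrite subr0.
apply: csub_closed => B /nbhs_ballP[e /= e0 Be].
have [u uq ue] : exists2 u, \pi_Q u = q & `|u| < e.
  by apply: qnorm_lift; rewrite q0.
exists (repr q - u); split; first by apply/pi_eqP; rewrite reprK.
by apply: Be; rewrite -ball_normE /ball_/= opprB addrCA subrr addr0.
Qed.

HB.instance Definition _ := Lmodule_isNormed.Build K Q qnormD qnormZ qnorm0_eq0.

End quotient_space.

Section quotient_complete.
Variables (K : scalarFieldType) (V : completeNormedModType K).
Variable N : closedSubspace V.
Local Notation Q := (quotSpace N).

Lemma norm_pi_le (u : V) : `|\pi_Q u| <= `|u|.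
Proof. exact: qnorm_le. Qed.

Lemma norm_lift (q : Q) (e : K) : `|q| < e -> exists2 u, \pi_Q u = q & `|u| < e.
Proof. exact: qnorm_lift. Qed.

Lemma lift_summable (x : nat -> Q) :
  (forall n, `|x n.+1 - x n| < 2^-1 ^+ n *+ 2) ->
  exists2 u : nat -> V, (forall n, \pi_Q (u n) = x n) &
    forall n m, `|u (n + m)%N - u n| <= 2^-1 ^+ n *+ 4.
Proof.
move=> xS.
have /choice[d dP] : forall n, exists v : V,
    \pi_Q v = x n.+1 - x n /\ `|v| < 2^-1 ^+ n *+ 2.
  by move=> n; have [v] := norm_lift (xS n); exists v.
pose u n := repr (x 0%N) + \sum_(i < n) d i.
have uS n : u n.+1 = u n + d n by rewrite /u big_ord_recr addrA.
exists u => [|n m].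
  elim=> [|n IH]; first by rewrite /u big_ord0 addr0 reprK.
  by rewrite uS pi_add IH (dP n).1 addrC subrK.
apply: (@le_trans _ _ (2^-1 ^+ n *+ 4 - 2^-1 ^+ (n + m) *+ 4)); last first.
  by rewrite gerBl mulrn_wge0// exprn_ge0// invr_ge0.
elim: m => [|m IH]; first by rewrite addn0 !subrr normr0.
rewrite addnS uS addrAC (le_trans (ler_normD _ _))//.
apply: (le_trans (lerD IH (ltW (dP _).2))).
rewrite -addrA lerD2l exprS; set a := 2^-1 ^+ (n + m).
have -> : (2^-1 * a) *+ 4 = a *+ 2.
  by rewrite -[4%N]/(2 * 2)%N mulrnA -mulrnAl -[2^-1 *+ 2]mulr_natr mulVf ?mul1r ?pnatr_eq0.
have -> : a *+ 4 = a *+ 2 + a *+ 2 by rewrite -mulrnDr.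
by rewrite opprD subrK.
Qed.

Lemma quot_complete (F : set_system Q) : ProperFilter F -> cauchy F -> cvg F.
Proof.
move=> FF /cauchyP Fc.
have h0 n : (0 : K) < 2^-1 ^+ n by rewrite exprn_gt0// invr_gt0.
have /choice[x Fx] : forall n, exists x : Q, F (ball x (2^-1 ^+ n)).
  by move=> n; exact: Fc.
have [n|u ux uC] := @lift_summable x.
  have [y [ny ny1]] := filter_ex (filterI (Fx n) (Fx n.+1)).
  rewrite -(subrKA y) (le_lt_trans (ler_normD _ _))//.
  move: ny ny1; rewrite -!ball_normE /ball_/= => ny ny1.
  rewrite mulr2n ltrD//; last by rewrite distrC.
  rewrite (lt_le_trans ny1)// exprS ler_piMl ?(ltW (h0 n))//.
  by rewrite invf_le1// ler1n.
have /cauchy_cvg uc : cauchy (u @ \oo).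
  apply: cauchy_exP => e e0.
  have e40 : 0 < e / 4 by rewrite divr_gt0.
  have [n ne] := scalar_half_small e40.
  exists (u n); exists n => // m /= nm.
  rewrite -ball_normE /ball_/= distrC -(subnKC nm) (le_lt_trans (uC _ _))//.
  by rewrite -mulr_natr -ltr_pdivlMr.
apply/cvg_ex; exists (\pi_Q (lim (u @ \oo))).
apply/cvg_ballP => e e0.
have e20 : 0 < e / 2 by rewrite divr_gt0.
have [m me] := scalar_half_small e20.
have : \forall n \near \oo, `|lim (u @ \oo) - u n| < e / 2.
  by move/(cvgrPdist_lt): uc; apply.
case=> p _ /(_ (maxn p m)) /= /(_ (leq_maxl _ _)) pe.
apply: filterS (Fx (maxn p m)) => y; rewrite -!ball_normE /ball_/= => ye.
rewrite -(subrKA (x (maxn p m))) (le_lt_trans (ler_normD _ _))//.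
rewrite [e]splitr ltrD//.
  rewrite -ux (le_lt_trans _ pe)//.
  have -> : \pi_Q (lim (u @ \oo)) - \pi_Q (u (maxn p m)) =
            \pi_Q (lim (u @ \oo) - u (maxn p m)) by rewrite !piE.
  exact: norm_pi_le.
rewrite (lt_trans ye)// (le_lt_trans _ me)// ler_wiXn2l ?leq_maxr// ?invr_ge0//.
by rewrite invf_le1// ler1n.
Qed.

HB.instance Definition _ := Uniform_isComplete.Build Q quot_complete.

End quotient_complete.

Section configurations.
Variables (K : scalarFieldType) (X : Type) (E : completeNormedModType K).

(* A Banach space of functions X -> E is a Banach space with an injective
   linear map to X -> E, whose linear structure is the pointwise one. *)
Record GRKBS := MkGRKBS {
  grkbs_space :> completeNormedModType K;
  grkbs_fun : {linear grkbs_space -> (X -> E)};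
  grkbs_inj : injective grkbs_fun;
  grkbs_eval_bounded : forall x, bounded_op (fun f => grkbs_fun f x)
}.

Definition feature_fun (F : completeNormedModType K) (phi : X -> Lop F E)
  (mu : F) : X -> E := fun x => phi x mu.

(* The default value 0 of `infimum` is never used: the first condition makes
   the set of representatives of f nonempty. *)
Definition configuration (B : GRKBS) (F : completeNormedModType K)
    (phi : X -> Lop F E) : Prop :=
  range (grkbs_fun B) = range (feature_fun phi) /\
  forall f : B, `|f| =
    infimum 0 [set `|mu| | mu in [set mu | grkbs_fun B f = feature_fun phi mu]].

Section pullback.
Variables (F Ft : completeNormedModType K) (phi : X -> Lop F E).
Variable J : isoIsom Ft F.

Definition pullback_feature : X -> Lop Ft E := fun x => lop_comp_iso (phi x) J.

Definition pullback_null_set : set Ft := [set mu | forall x, phi x (J mu) = 0].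

Lemma pullback_null0 : pullback_null_set 0.
Proof. by move=> x; rewrite !linear0. Qed.

Lemma pullback_nullD u v : pullback_null_set u -> pullback_null_set v ->
  pullback_null_set (u + v).
Proof. by move=> Nu Nv x; rewrite !linearD Nu Nv addr0. Qed.

Lemma pullback_nullZ (a : K) u :
  pullback_null_set u -> pullback_null_set (a *: u).
Proof. by move=> Nu x; rewrite linearZ linearZ /= Nu scaler0. Qed.

Lemma pullback_null_closed : closed pullback_null_set.
Proof.
have -> : pullback_null_set =
    \bigcap_x (pullback_feature x @^-1` [set 0]).
  by apply/seteqP; split=> [u Nu x _|u Nu x]; [exact: Nu|exact: (Nu x)].
apply: closed_bigI => x _; apply: preimage_closed => [u _|].
  exact: lop_continuous.
exact/accessible_closed_set1/hausdorff_accessible/norm_hausdorff.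
Qed.

Definition pullback_null : closedSubspace Ft := ClosedSubspace
  pullback_null0 pullback_nullD pullback_nullZ pullback_null_closed.

End pullback.

End configurations.

(* Main.v *)
(* Since J is a norm-preserving bijection, a function has the same set of norms
   of representatives in Ft as in F, so the configuration transports along J.
   For any configuration, mu |-> f_mu factors through the quotient by its kernel
   N, and the representatives of f_mu are exactly the coset mu + N: the quotient
   norm and the norm of B are infima over the same set. *)
Require Import Defs.
From HB Require Import structures.
From mathcomp Require Import all_boot all_order all_algebra.
From mathcomp Require Import all_classical all_reals.
From mathcomp Require Import topology normedtype sequences.
From mathcomp Require Import generic_quotient.

Set Implicit Arguments.
Unset Strict Implicit.
Unset Printing Implicit Defensive.

Import Order.TTheory GRing.Theory Num.Theory.
Import numFieldNormedType.Exports.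

Local Open Scope classical_set_scope.
Local Open Scope ring_scope.
Local Open Scope quotient_scope.

Lemma configuration_pullback (K : scalarFieldType) (X : Type)
    (E : completeNormedModType K) (B : GRKBS X E)
    (F : completeNormedModType K) (phi : X -> Lop F E)
    (Ft : completeNormedModType K) (J : isoIsom Ft F) :
  configuration B phi -> configuration B (pullback_feature phi J).
Proof.
have [J' JK J'K] := iso_bij J.
(* Holds by conversion. Below, representatives over [F] move to [Ft] by [J'], those over [Ft] to [F]
   by [J]. *)
have funJ u : feature_fun (pullback_feature phi J) u = feature_fun phi (J u) by [].
move=> [rangeB normB]; split.
  rewrite rangeB; apply/seteqP; split=> _ [mu _ <-].
    by exists (J' mu) => //; rewrite funJ J'K.
  by exists (J mu).
move=> f; rewrite normB; congr (infimum _ _).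
apply/seteqP; split=> _ [mu /= fmu <-].
  by exists (J' mu); rewrite /= ?funJ -?(iso_norm J) J'K.
by exists (J mu); rewrite ?iso_norm.
Qed.

(** Describing [N] by its membership condition allows a null set written pointwise, with its
    closedness already bundled. *)
Lemma configuration_quotient (K : scalarFieldType) (X : Type)
    (E : completeNormedModType K) (B : GRKBS X E)
    (F : completeNormedModType K) (phi : X -> Lop F E) (N : closedSubspace F) :
  configuration B phi -> (forall mu, csub_set N mu <-> feature_fun phi mu = 0) ->
  isom_isomorphic (quotSpace N) B.
Proof.
move=> [rangeB normB] kerN; set Q := quotSpace N.
have featB a u v :
    feature_fun phi (a *: u + v) = a *: feature_fun phi u + feature_fun phi v.
  by apply/funext => x; rewrite /feature_fun linearP.
(* Cosets of [N] are the fibres of the feature map; [u - v] is rewritten as [-1 *: v + u] to match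
   [featB]. *)
have pi_feat u v : \pi_Q u = \pi_Q v <-> feature_fun phi u = feature_fun phi v.
  rewrite pi_eqP kerN addrC -scaleN1r featB scaleN1r addrC.
  by split=> [/eqP|->]; rewrite ?subrr// subr_eq0 => /eqP.
(* [T] is chosen through [repr]; [Tpi] then shows that any other representative gives the same
   function. *)
have /choice[T TE] : forall q : Q, exists f : B,
    grkbs_fun B f = feature_fun phi (repr q).
  move=> q; have : range (feature_fun phi) (feature_fun phi (repr q)).
    by exists (repr q).
  by rewrite -rangeB => -[f _ fq]; exists f.
have Tpi u : grkbs_fun B (T (\pi_Q u)) = feature_fun phi u.
  by rewrite TE; apply/pi_feat; rewrite reprK.
have Tlin : linear T.
  move=> a p q; apply: (@grkbs_inj _ _ _ B).
  rewrite linearP -[p]reprK -[q]reprK -[a *: _]pi_scale -Defs.pi_add !Tpi.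
  exact: featB.
pose Tl : {linear Q -> B} :=
  HB.pack T (GRing.isLinear.Build K Q B _ T Tlin).
have Tbij : bijective Tl.
  have Tinj : injective T.
    move=> p q /(congr1 (grkbs_fun B)); rewrite !TE => /pi_feat.
    by rewrite !reprK.
  (* Surjectivity uses the other inclusion between the two ranges. *)
  have /choice[S SK] : forall f : B, exists q, T q = f.
    move=> f; have : range (grkbs_fun B) (grkbs_fun B f) by exists f.
    rewrite rangeB => -[mu _ muf]; exists (\pi_Q mu).
    by apply: (@grkbs_inj _ _ _ B); rewrite Tpi.
  by exists S => // q; apply: Tinj; rewrite SK.
constructor; apply: (@IsoIsom _ _ _ Tl Tbij) => q /=.
(* Both norms are now infima with default 0, so it remains to match the sets: by [pi_feat], [mu]
   represents [T q] iff its class is [q]. *)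
rewrite normB [RHS]/(qnorm q) /qnorm; congr (infimum _ _).
by apply/seteqP; split=> _ [mu /= muq <-]; exists mu => //=;
  [rewrite -[q]reprK; apply/pi_feat; rewrite -TE|rewrite -muq Tpi].
Qed.

Theorem theorem13 (K : scalarFieldType) (X : Type)
    (E : completeNormedModType K) (B : GRKBS X E)
    (F : completeNormedModType K) (phi : X -> Lop F E)
    (Bphi : configuration B phi)
    (Ft : completeNormedModType K) (J : isoIsom Ft F) :
  isom_isomorphic (quotSpace (pullback_null phi J)) B /\
  configuration B (pullback_feature phi J).
Proof.
have Bpsi := configuration_pullback J Bphi; split=> //.
(* Using the configuration over [Ft] itself avoids comparing quotients of [Ft] and [F]; only
   pointwise vanishing versus equality to the zero function is left. *)
apply: (configuration_quotient Bpsi) => mu.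
by split=> [Nmu|/funeqP Nmu //]; exact/funext.
Qed.
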